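(* Let $\{x_k\}_{k\ge0}$ be the iterates produced by iBasic started from $x_0\in\mathbb{R}^n$, with inexactness errors $\epsilon_k\in\mathbb{R}^n$. Let $y_0=0\in\mathbb{R}^m$ and let $\{y_k\}_{k\ge0}$ be the iterates of iSDSA (with the same $x_0$), with inexactness errors $\epsilon_k^d\in\mathbb{R}^m$. Assume that the two methods use the same stepsize $\omega>0$ and the same sequence of random matrices $\mathbf{S}_k$, and that $\epsilon_k=\mathbf{B}^{-1}\mathbf{A}^\top\epsilon_k^d$ for all $k\ge 0$. Then for all $k\ge0$ $$x_k=\phi(y_k):=x_0+\mathbf{B}^{-1}\mathbf{A}^\top y_k .$$
   Context: Let $\mathbf{A}\in\mathbb{R}^{m\times n}$, $b\in\mathbb{R}^m$ be such that the linear system $\mathbf{A}x=b$ is consistent, and let $\mathbf{B}\in\mathbb{R}^{n\times n}$ be symmetric positive definite. $^\dagger$ is the Moore-Penrose pseudoinverse. Let $\mathcal{D}$ be a distribution over real matrices with $m$ rows. iBasic (inexact basic method): for $k=0,1,2,\dots$ draw a fresh sample $\mathbf{S}_k\sim\mathcal{D}$ and set $$x_{k+1}=x_k-\omega\mathbf{B}^{-1}\mathbf{A}^\top\mathbf{S}_k(\mathbf{S}_k^\top\mathbf{A}\mathbf{B}^{-1}\mathbf{A}^\top\mathbf{S}_k)^\dagger\mathbf{S}_k^\top(\mathbf{A}x_k-b)+\epsilon_k.$$ iSDSA (inexact stochastic dual subspace ascent): with $y_0=0$ and given $x_0$, for $k=0,1,2,\dots$ draw a fresh sample $\mathbf{S}_k\sim\mathcal{D}$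 and set $$y_{k+1}=y_k+\omega\mathbf{S}_k(\mathbf{S}_k^\top\mathbf{A}\mathbf{B}^{-1}\mathbf{A}^\top\mathbf{S}_k)^\dagger\mathbf{S}_k^\top\big(b-\mathbf{A}(x_0+\mathbf{B}^{-1}\mathbf{A}^\top y_k)\big)+\epsilon_k^d.$$ *)

(* Defs.v *)
From HB Require Import structures.
From mathcomp Require Import all_boot all_order all_algebra finmap.
From mathcomp Require Import all_classical all_reals all_analysis.

Set Implicit Arguments.
Unset Strict Implicit.
Unset Printing Implicit Defensive.

Import Order.TTheory GRing.Theory Num.Theory.
Import numFieldNormedType.Exports.

Local Open Scope classical_set_scope.
Local Open Scope ring_scope.

Definition spd (R : realType) (n : nat) (B : 'M[R]_n) : Prop :=
  B^T = B /\ forall x : 'cV[R]_n, x != 0 -> 0 < (x^T *m B *m x) 0 0.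

Definition is_pseudoinverse (R : realType) (p q : nat)
    (M : 'M[R]_(p, q)) (X : 'M[R]_(q, p)) : Prop :=
  [/\ M *m X *m M = M, X *m M *m X = X,
      (M *m X)^T = M *m X & (X *m M)^T = X *m M].

(* The Moore-Penrose pseudoinverse; [pseudoinverseP] and
   [pseudoinverse_unique] show that the default value 0 is never taken and
   that the choice is determined.  (MathComp's [pinvmx] is only a partial
   inverse, without the symmetry conditions.) *)
Definition pseudoinverse (R : realType) (p q : nat)
    (M : 'M[R]_(p, q)) : 'M[R]_(q, p) :=
  xget 0 [set X | is_pseudoinverse M X].

Lemma spd_unitmx (R : realType) (n : nat) (B : 'M[R]_n) :
  spd B -> B \in unitmx.
Proof.
move=> [symB posB]; rewrite -row_free_unit -kermx_eq0.
apply/eqP/row_matrixP => i; rewrite row0; apply/eqP/negPn/negP => u0.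
have uB : row i (kermx B) *m B = 0 by rewrite -row_mul mulmx_ker row0.
have := posB (row i (kermx B))^T; rewrite trmxK uB mul0mx mxE ltxx.
by rewrite -(inj_eq trmx_inj) trmxK trmx0 => /(_ u0).
Qed.

Lemma gram_unitmx (R : realType) (p q : nat) (F : 'M[R]_(p, q)) :
  row_free F -> F *m F^T \in unitmx.
Proof.
move=> freeF; apply: spd_unitmx; split; first by rewrite trmx_mul trmxK.
move=> x x0; have ->: x^T *m (F *m F^T) *m x = (x^T *m F) *m (x^T *m F)^T.
  by rewrite trmx_mul trmxK !mulmxA.
set u := x^T *m F; have u0 : u != 0.
  apply: contraNneq x0 => u0; rewrite -(inj_eq trmx_inj) trmx0.
  by apply/eqP/(row_free_inj freeF); rewrite mul0mx.
have sq j : 0 <= u 0 j * u^T j 0 by rewrite [u^T j 0]mxE -expr2 sqr_ge0.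
rewrite mxE lt_neqAle sumr_ge0 // andbT; apply: contraNneq u0 => /esym s0.
apply/eqP/rowP => j; have /= := psumr_eq0P (fun j _ => sq j) s0 (i := j) isT.
by move/eqP; rewrite [u^T j 0]mxE -expr2 sqrf_eq0 [RHS]mxE => /eqP.
Qed.

Lemma pseudoinverse_unique (R : realType) (p q : nat) (M : 'M[R]_(p, q))
    (X Y : 'M[R]_(q, p)) :
  is_pseudoinverse M X -> is_pseudoinverse M Y -> X = Y.
Proof.
move=> [X1 X2 X3 X4] [Y1 Y2 Y3 Y4].
have MXY : M *m X = M *m Y.
  rewrite -[LHS]X3 -[in LHS]Y1 -(mulmxA (M *m Y)) trmx_mul X3 Y3.
  by rewrite mulmxA X1.
have XYM : X *m M = Y *m M.
  rewrite -[LHS]X4 -[in LHS]Y1 -mulmxA (mulmxA X) trmx_mul X4 Y4.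
  by rewrite -mulmxA (mulmxA M) X1.
by rewrite -X2 -mulmxA MXY mulmxA XYM.
Qed.

Lemma pseudoinverseP (R : realType) (p q : nat) (M : 'M[R]_(p, q)) :
  is_pseudoinverse M (pseudoinverse M).
Proof.
apply: (@xgetPex _ 0 [set X | is_pseudoinverse M X]).
move: (mulmx_base M) (row_base_free M) (col_base_full M).
move: (\rank M) (col_base M) (row_base M) => r C F MCF freeF fullC.
have uF : F *m F^T \in unitmx by exact: gram_unitmx.
have uC : C^T *m C \in unitmx.
  rewrite -[X in _ *m X]trmxK; apply: gram_unitmx.
  by rewrite /row_free mxrank_tr.
set iF := invmx (F *m F^T); set iC := invmx (C^T *m C).
have MX : M *m (F^T *m iF *m iC *m C^T) = C *m iC *m C^T.
  rewrite -{1}MCF -!mulmxA; congr (_ *m _).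
  by rewrite (mulmxA F) mulKVmx.
have XM : F^T *m iF *m iC *m C^T *m M = F^T *m iF *m F.
  by rewrite -MCF -!mulmxA (mulmxA C^T) mulKmx.
have iCT : iC^T = iC by rewrite trmx_inv trmx_mul trmxK.
have iFT : iF^T = iF by rewrite trmx_inv trmx_mul trmxK.
exists (F^T *m iF *m iC *m C^T); split; rewrite ?MX ?XM.
- by rewrite -{1}MCF -!mulmxA (mulmxA C^T) mulKmx // MCF.
- by rewrite -!mulmxA (mulmxA F) (mulKVmx uF).
- by rewrite !trmx_mul trmxK iCT mulmxA.
- by rewrite !trmx_mul trmxK iFT mulmxA.
Qed.

(* Real matrices with m rows and any number of columns, with the Borel
   sigma-algebra of the disjoint union of the spaces 'M_(m, q). *)
Definition rowmx_space (R : realType) (m : nat) : Type :=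
  {q : nat & 'M[R]_(m, q)}.

HB.instance Definition _ (R : realType) (m : nat) :=
  Topological.copy (rowmx_space R m) {q : nat & 'M[R]_(m, q)}.
HB.instance Definition _ (R : realType) (m : nat) :=
  isPointed.Build (rowmx_space R m) (@existT nat (fun q => 'M[R]_(m, q)) 0%N (0 : 'M[R]_(m, 0))).

Definition sketch (R : realType) (m : nat) :=
  g_sigma_algebraType (@open (rowmx_space R m)).

Definition independent_seq (R : realType) (d d' : measure_display)
    (T : measurableType d) (T' : measurableType d') (P : probability T R)
    (X : nat -> {RV P >-> T'}) : Prop :=
  forall (J : {fset nat}) (E : nat -> set T'),
    (forall k, measurable (E k)) ->
    P (\bigcap_(k in [set` J]) (X k @^-1` E k)) =
    (\prod_(k <- J) P (X k @^-1` E k))%E.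

Definition iid (R : realType) (d d' : measure_display)
    (T : measurableType d) (T' : measurableType d') (P : probability T R)
    (D : probability T' R) (X : nat -> {RV P >-> T'}) : Prop :=
  (forall k E, measurable E -> distribution P (X k) E = D E) /\
  independent_seq X.

Section methods.
Context (R : realType) (m n : nat).
Variables (A : 'M[R]_(m, n)) (B : 'M[R]_n) (b : 'cV[R]_m) (w : R).

Definition sketch_proj (s : rowmx_space R m) : 'M[R]_m :=
  let S := projT2 s in
  S *m pseudoinverse (S^T *m A *m invmx B *m A^T *m S) *m S^T.

Fixpoint iBasic (x0 : 'cV[R]_n) (S : nat -> rowmx_space R m)
    (eps : nat -> 'cV[R]_n) (k : nat) : 'cV[R]_n :=
  if k is k'.+1 then
    let x := iBasic x0 S eps k' in
    x - w *: (invmx B *m A^T *m sketch_proj (S k') *m (A *m x - b)) + eps k'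
  else x0.

Fixpoint iSDSA (x0 : 'cV[R]_n) (S : nat -> rowmx_space R m)
    (epsd : nat -> 'cV[R]_m) (k : nat) : 'cV[R]_m :=
  if k is k'.+1 then
    let y := iSDSA x0 S epsd k' in
    y + w *: (sketch_proj (S k') *m (b - A *m (x0 + invmx B *m A^T *m y)))
      + epsd k'
  else 0.

End methods.

(* Main.v *)
Require Import Defs.
From mathcomp Require Import all_boot all_order all_algebra finmap.
From mathcomp Require Import all_classical all_reals all_analysis.
Import Order.TTheory GRing.Theory Num.Theory.
Import numFieldNormedType.Exports.
Local Open Scope classical_set_scope.
Local Open Scope ring_scope.

(** The identity is pathwise: at a fixed outcome [t], the affine map sending [y] to
    [x0 + invmx B *m A^T *m y] carries each iSDSA step to the iBasic step with the same sketch, and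
    [eps_epsd] matches the errors. Induction on [k] starts from [y = 0], which is sent to [x0]. *)

Theorem theorem8 (R : realType) (m n : nat)
    (A : 'M[R]_(m, n)) (b : 'cV[R]_m) (B : 'M[R]_n)
    (consistent : exists x : 'cV[R]_n, A *m x = b)
    (spdB : spd B)
    (D : probability (sketch R m) R)
    (d : measure_display) (T : measurableType d) (P : probability T R)
    (S : nat -> {RV P >-> sketch R m}) (iidS : iid D S)
    (w : R) (w_gt0 : 0 < w) (x0 : 'cV[R]_n)
    (eps : nat -> T -> 'cV[R]_n) (epsd : nat -> T -> 'cV[R]_m)
    (eps_epsd : forall (k : nat) (t : T),
      eps k t = invmx B *m A^T *m epsd k t)
    (x : nat -> T -> 'cV[R]_n)
    (xE : forall (k : nat) (t : T),
      x k t = iBasic A B b w x0 (fun j => S j t) (fun j => eps j t) k)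
    (y : nat -> T -> 'cV[R]_m)
    (yE : forall (k : nat) (t : T),
      y k t = iSDSA A B b w x0 (fun j => S j t) (fun j => epsd j t) k) :
  forall (k : nat) (t : T), x k t = x0 + invmx B *m A^T *m y k t.
Proof.
move=> k t; rewrite xE yE; elim: k => [|k IHk] /=; first by rewrite mulmx0 addr0.
(* iBasic subtracts a multiple of [A x - b], iSDSA adds one of [b - A x]; flipping the sign makes
   the residuals agree. *)
rewrite IHk eps_epsd -[A *m _ - b]opprB mulmxN scalerN opprK.
(* The pattern [_ *m A^T] distributes only the outer [invmx B *m A^T], keeping the common residual
   intact. *)
by rewrite !(mulmxDr (_ *m A^T)) -scalemxAr !mulmxA !addrA.
Qed.
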